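(* Let $k,m,n,r$ be positive integers and let $G$ and $H$ be finite abelian groups. Then the following hold. (1) If $\gcd(|G|,|H|)=1$, then there are bijections between the sets $\mathsf M(G,|H|)$, $\mathsf M(H,|G|)$, and $\mathcal D_{|G|,|H|}$. Therefore $$|\mathsf M(G,|H|)|=|\mathsf M(H,|G|)|=\mathsf{Cat}_{|G|,|H|}.$$ (2) If $G=C_n^r$ and $H=C_m^r$ with $\gcd(n,m^r)=\gcd(n^r,m)$, then $$|\mathsf M(G,|H|)|=|\mathsf M(H,|G|)|.$$ (3) If $k<|G|$ and $\gcd(k,|G|)=1$, then there are bijections between the sets $\mathsf N(G,k)$, $\mathsf N(G,|G|-k)$, and $\mathcal D_{k,|G|-k}$. Therefore $$|\mathsf N(G,k)|=|\mathsf N(G,|G|-k)|=\frac{1}{|G|}\binom{|G|}{k}=\mathsf{Cat}_{k,|G|-k}.$$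
   Context: Groups are written additively. $C_n$ denotes the cyclic group of order $n$ and $C_n^r$ the direct sum of $r$ copies of $C_n$. A sequence over a finite abelian group $G$ is a finite unordered sequence of elements of $G$ with repetition allowed (that is, a finite multiset of elements of $G$); its length $|S|$ is the number of terms counted with multiplicity, and $\sigma(S)\in G$ is the sum of its terms counted with multiplicity. For a subset $S\subseteq G$, $\sigma(S)$ is the sum of its elements and $|S|$ its cardinality. For a positive integer $m$, $\mathsf M(G,m)$ is the set of all sequences $S$ over $G$ with $|S|=m$ and $\sigma(S)=0$. For a positive integer $k\le |G|$, $\mathsf N(G,k)$ is the set of all subsets $S\subseteq G$ with $|S|=k$ and $\sigma(S)=0$. For coprime positive integers $a,b$, the rational Catalan number is $\mathsf{Cat}_{a,b}=\frac{1}{a+b}\binom{a+b}{a}$, and $\mathcal D_{a,b}$ is the set of all $(a,b)$-Dyck paths, i.e. lattice paths from $(0,0)$ to $(a,b)$ which use only unit steps $(1,0)$ and $(0,1)$ and stay (weakly) above the diagonal line $y=\frac{b}{a}x$. *)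

(* Defs.v *)
From HB Require Import structures.
From mathcomp Require Import all_boot all_order all_algebra.
From mathcomp Require Import finmap multiset.

Set Implicit Arguments.
Unset Strict Implicit.
Unset Printing Implicit Defensive.

Import Order.TTheory GRing.Theory Num.Theory.

Local Open Scope fset_scope.
Local Open Scope mset_scope.
Local Open Scope ring_scope.

(* The library's {mset G} has no finType structure, so the finite set of
   multisets of given size is obtained by forgetting the order of tuples;
   lemma in_zsM below gives the expected membership criterion. *)
Definition zsM (G : finZmodType) (m : nat) : {fset {mset G}} :=
  [fset seq_mset t
     | t : m.-tuple G in [pred t : m.-tuple G | \sum_(g <- t) g == 0]].

Lemma in_zsM (G : finZmodType) (m : nat) (S : {mset G}) :
  (S \in zsM G m) = (size S == m) && (\sum_(g <- S) g == 0).
Proof.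
apply/imfsetP/andP => [[t /= + ->]|[/eqP szS S0]].
  move=> /eqP t0; rewrite (perm_size (perm_eq_seq_mset t)) size_tuple.
  by rewrite (perm_big _ (perm_eq_seq_mset t)) /= t0 !eqxx.
exists (tcast szS (in_tuple S)); last by rewrite val_tcast seq_mset_id.
by rewrite /in_mem /= val_tcast.
Qed.

Definition zsN (G : finZmodType) (k : nat) : {set {set G}} :=
  [set A : {set G} | (#|A| == k) && (\sum_(g in A) g == 0)].

Definition Cat (a b : nat) : rat := (a + b)%:R^-1 * 'C(a + b, a)%:R.

(* A lattice path starting at (0,0) is its word of steps: [false] is the step
   (1,0) and [true] is the step (0,1); [endpoint] is the point reached. *)
Definition endpoint (s : seq bool) : nat * nat :=
  (count_mem false s, count_mem true s).

(* A path to (a,b) has a+b steps. Since the half-plane above the diagonal is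
   convex, it suffices to constrain the lattice points visited by the path. *)
Definition Dyck (a b : nat) : {set (a + b).-tuple bool} :=
  [set p : (a + b).-tuple bool | (endpoint p == (a, b)) &&
     [forall i : 'I_(a + b).+1,
        let: (x, y) := endpoint (take i p) in
        b%:R / a%:R * x%:R <= y%:R :> rat]].

Definition in_bijection (T U : Type) (A : {pred T}) (B : {pred U}) : Prop :=
  exists f : {x : T | x \in A} -> {y : U | y \in B}, bijective f.

(* For n > 0, 'I_n.-1.+1 is Z/nZ, including the trivial group for n = 1
   (whereas 'Z_1 has two elements). *)
Definition isoCr (G : finZmodType) (n r : nat) : Prop :=
  exists f : {additive G -> {ffun 'I_r -> 'I_n.-1.+1}}, bijective f.

(* Main.v *)
(** (1) and (3): translating all terms of a sequence (or a subset) of length m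
    by x changes its sum by m x, so when m is prime to |G| all sums are taken
    equally often.  For Dyck paths, the height of a word with a steps (1,0) and
    b steps (0,1) after j steps is congruent to a j modulo a + b, so it has a
    unique minimum and exactly one rotation of the word is a Dyck path.  The
    bijections are obtained by comparing cardinals.

    (2): for a symmetric perfect pairing p on G with values in roots of unity,
    orthogonality gives
      |G| |M(G,m)| = sum_y [X^m] prod_g 1 / (1 - p(g,y) X),
    and the product is (1 - X^d)^(-|G|/d), where d is the order of y.  Hence
      (|G| + m) |M(G,m)| = sum_(y : d | m) binom((|G| + m)/d, |G|/d).
    For m = |H| the summand is symmetric in G and H, the gcd condition says that
    the same orders d occur on both sides, and the number of elements of order
    d | n in C_n^r does not depend on n, because C_n^r has d^r elements killed
    by d. *)

Require Import Defs.
From mathcomp Require Import all_boot all_order all_algebra fingroup cyclic algC cyclotomic.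
From mathcomp Require Import finmap multiset zify ring.

Set Implicit Arguments.
Unset Strict Implicit.
Unset Printing Implicit Defensive.

Import Order.TTheory GRing.Theory Num.Theory.

Local Open Scope ring_scope.

(** * Multisets as multiplicity functions *)

Lemma big_seq_count (T : finType) (V : nmodType) (s : seq T) (F : T -> V) :
  \sum_(x <- s) F x = \sum_x F x *+ count_mem x s.
Proof.
elim: s => [|a s IHs]; first by rewrite big_nil big1 // => x _; rewrite mulr0n.
rewrite big_cons IHs (bigD1 a) //= [in RHS](bigD1 a) //= eqxx mulrnDr addrA.
by congr (_ + _); apply: eq_bigr => x /negPf; rewrite eq_sym => ->.
Qed.

(* A multiset of size m has all its multiplicities at most m, hence is a
   function into 'I_m.+1. *)
Definition mults (T : finType) (m : nat) : {set {ffun T -> 'I_m.+1}} :=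
  [set f : {ffun T -> 'I_m.+1} | (\sum_x f x == m)%N].

Definition wsum (G : finZmodType) (m : nat) (f : {ffun G -> 'I_m.+1}) : G :=
  \sum_g g *+ f g.

(** Read along the enumeration of [T], such a function is an ordered partition of [m] into [#|T|]
    parts, which [card_ord_partitions] counts. *)
Lemma card_mults (T : finType) (m : nat) :
  (0 < #|T|)%N -> #|mults T m| = 'C(#|T|.-1 + m, m).
Proof.
move=> T_gt0; have [N cardT] : exists N, #|T| = N.+1.
  by exists #|T|.-1; rewrite prednK.
rewrite cardT /= -[RHS]bin_sub ?leq_addl // addnK -card_ord_partitions.
pose t_of (f : {ffun T -> 'I_m.+1}) : N.+1.-tuple 'I_m.+1 :=
  tcast cardT (fgraph f).
have t_inj : injective t_of.
  move=> f g /(congr1 val); rewrite /= !val_tcast => /val_inj.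
  exact: (can_inj fgraphK).
have sum_t f : (\sum_(i <- t_of f) i = \sum_x f x)%N.
  by rewrite val_tcast -codom_ffun big_image.
rewrite -(card_imset _ t_inj); apply: eq_card => t; apply/imsetP/idP.
  by case=> f + ->; rewrite !inE sum_t.
rewrite inE => tm; pose f : {ffun T -> 'I_m.+1} := Finfun (tcast (esym cardT) t).
have tE : t = t_of f by rewrite /t_of FinfunK; apply: val_inj; rewrite /= !val_tcast.
by exists f => //; rewrite inE -sum_t -tE.
Qed.

(** A multiset is determined by its multiplicities, and [s_of] lists elements with prescribed ones;
    counting then takes place in a finite type. *)
Lemma card_zsM (G : finZmodType) (m : nat) :
  #|` zsM G m|%fset = #|[set f in mults G m | wsum f == 0]|.
Proof.
pose s_of (f : {ffun G -> 'I_m.+1}) := flatten [seq nseq (f g) g | g <- enum G].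
have countE f g : count_mem g (s_of f) = f g.
  rewrite count_flatten -map_comp sumnE big_map big_enum /= (bigD1 g) //=.
  rewrite count_nseq /= eqxx mul1n big1 ?addn0 // => h /negPf hg.
  by rewrite count_nseq /= hg.
have inj : injective (fun f => seq_mset (s_of f)).
  move=> f g fg; apply/ffunP => x; apply: val_inj.
  by rewrite /= -!countE -!mset_seqE fg.
have size_sum (S : multiset G) : size S = (\sum_g S g)%N.
  rewrite -[LHS]sum1_size (big_seq_count (V := nat)).
  apply: eq_bigr => g _; rewrite count_mem_mset.
  by rewrite natn.
have sum_sum (S : multiset G) : \sum_(g <- S) g = \sum_g g *+ S g.
  by rewrite big_seq_count; under eq_bigr do rewrite count_mem_mset.
have msetE f g : seq_mset (s_of f) g = f g by rewrite mset_seqE countE.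
rewrite cardE -(size_map (fun f => seq_mset (s_of f))); apply/perm_size/uniq_perm.
- exact: fset_uniq.
- by rewrite map_inj_uniq ?enum_uniq.
move=> S; rewrite in_zsM; apply/andP/mapP => /=.
  (* No multiplicity exceeds the size [m], so [inord] below never returns its default. *)
  move=> [/eqP szS S0]; have le_m g : (S g <= m)%N.
    by rewrite -szS size_sum (bigD1 g) //= leq_addr.
  exists [ffun g => inord (S g)]; rewrite ?mem_enum.
    rewrite !inE /wsum; apply/andP; split.
      under eq_bigr do rewrite ffunE inordK ?ltnS ?le_m //.
      by rewrite -size_sum szS.
    under eq_bigr do rewrite ffunE inordK ?ltnS ?le_m //.
    by rewrite -sum_sum.
  by apply/msetP => g; rewrite msetE ffunE inordK ?ltnS.
move=> [f + ->]; rewrite mem_enum !inE /wsum size_sum sum_sum.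
under [X in _ -> (X == _) /\ _]eq_bigr do rewrite msetE.
under [X in _ -> _ /\ (X == _)]eq_bigr do rewrite msetE.
by move=> /andP.
Qed.

(** * Bijections from equal cardinals *)

(** Elements with the same index correspond. Working with enumerating lists covers both the finite
    sets of multisets and the sets over a [finType]. *)
Lemma in_bijection_eq_size (T U : choiceType) (A : {pred T}) (B : {pred U})
    (s : seq T) (t : seq U) :
  uniq s -> uniq t -> s =i A -> t =i B -> size s = size t -> in_bijection A B.
Proof.
case: s => [|x0 s']; case: t => [|y0 t'] // s_uniq t_uniq sA tB sz_st.
  (* Both lists are empty here, and [nth] would lack a default element. *)
  have A0 (x : {x | x \in A}) : False by case: x => x; rewrite -sA.
  have B0 (y : {y | y \in B}) : False by case: y => y; rewrite -tB.
  by exists (fun x => False_rect _ (A0 x)); exists (fun y => False_rect _ (B0 y)) => z;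
    [case: (A0 z) | case: (B0 z)].
set s := x0 :: s' in s_uniq sA sz_st; set t := y0 :: t' in t_uniq tB sz_st.
clearbody s t.
have Bf (x : {x | x \in A}) : nth y0 t (index (val x) s) \in B.
  by rewrite -tB mem_nth // -sz_st index_mem sA (valP x).
have Ag (y : {y | y \in B}) : nth x0 s (index (val y) t) \in A.
  by rewrite -sA mem_nth // sz_st index_mem tB (valP y).
exists (fun x => exist (fun y : U => y \in B) _ (Bf x)).
exists (fun y => exist (fun x : T => x \in A) _ (Ag y)) => x;
  apply: val_inj; rewrite /= index_uniq ?nth_index //.
- by rewrite sA (valP x).
- by rewrite -sz_st index_mem sA (valP x).
- by rewrite tB (valP x).
- by rewrite sz_st index_mem tB (valP x).
Qed.

(** * Equidistribution of sums under translation *)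

(** The order of [x - y] divides both [m] and [#|G|], hence is 1. *)
Lemma mulrn_inj_coprime (G : finZmodType) (m : nat) :
  coprime #|G| m -> injective (fun x : G => x *+ m).
Proof.
move=> co_m x y /eqP; rewrite -subr_eq0 -mulrnBl -FinRing.zmodXgE => xy.
apply/eqP; rewrite -subr_eq0; move: xy; rewrite -order_dvdn => d_m.
rewrite -order_eq1 -dvdn1 -(eqP co_m) dvdn_gcd d_m andbT.
by rewrite -cardsT order_dvdG ?inE.
Qed.

(** Shifting by the [x] with [x *+ m = b - a] embeds the fibre of [w] over [a] into that over [b],
    so all [#|G|] fibres are equally large. The abstract [shift] serves multiplicity functions and
    subsets alike. *)
Lemma card_eq_shift (G : finZmodType) (X : finType) (D : {set X}) (w : X -> G)
    (shift : G -> X -> X) (m : nat) :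
    coprime #|G| m -> (forall x, injective (shift x)) ->
    (forall x, {in D, forall f, shift x f \in D}) ->
    (forall x, {in D, forall f, w (shift x f) = w f + x *+ m}) ->
  #|D| = (#|G| * #|[set f in D | w f == 0%R]|)%N.
Proof.
move=> co_m sh_inj shD w_sh.
have [div_m _ mulmK] := injF_bij (mulrn_inj_coprime co_m).
have le_fiber (a b : G) :
    (#|[set f in D | w f == a]| <= #|[set f in D | w f == b]|)%N.
  rewrite -(card_imset _ (sh_inj (div_m (b - a)))); apply/subset_leq_card/subsetP.
  move=> _ /imsetP[f + ->]; rewrite !inE => /andP[Df /eqP wf].
  by rewrite shD //= w_sh // mulmK wf addrC subrK.
rewrite -sum1_card (partition_big w predT) //=.
under eq_bigr => c _.
  rewrite sum1dep_card (_ : #|_| = #|[set f in D | w f == 0]|); last first.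
    by apply/eqP; rewrite eqn_leq !le_fiber.
  over.
by rewrite sum_nat_const.
Qed.

Lemma mul_bin_pred_add (a b : nat) :
  (0 < a -> (a + b) * 'C(a.-1 + b, b) = a * 'C(a + b, a))%N.
Proof.
case: a => // a _; have := mul_bin_down (a.+1 + b) b.
by rewrite addnK /= => ->; rewrite -['C(_ + b, b)]bin_sub ?leq_addl // addnK.
Qed.

Lemma card_zsM_coprime (G : finZmodType) (m : nat) : coprime #|G| m ->
  ((#|G| + m) * #|` zsM G m|%fset)%N = 'C(#|G| + m, #|G|).
Proof.
move=> co_m; have G_gt0 : (0 < #|G|)%N by apply/card_gt0P; exists 0.
pose shift (x : G) (f : {ffun G -> 'I_m.+1}) := [ffun g => f (g - x)].
apply/eqP; rewrite -(eqn_pmul2l G_gt0) mulnCA card_zsM; apply/eqP.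
rewrite -mul_bin_pred_add // -card_mults //; congr (_ * _)%N; symmetry.
apply: (card_eq_shift (shift := shift) co_m) => [x f g /ffunP fg|x f|x f].
- by apply/ffunP => y; have := fg (y + x); rewrite !ffunE addrK.
- rewrite !inE => /eqP fm; rewrite -[X in _ == X]fm; apply/eqP.
  rewrite (reindex_inj (addIr x)) /=.
  by apply: eq_bigr => g _; rewrite ffunE addrK.
rewrite inE => /eqP fm; rewrite /wsum (reindex_inj (addIr x)) /=.
rewrite -[in x *+ m]fm -sumrMnr -big_split /=; apply: eq_bigr => g _.
by rewrite ffunE addrK mulrnDl.
Qed.

Lemma card_zsN_coprime (G : finZmodType) (k : nat) : coprime #|G| k ->
  (#|G| * #|zsN G k|)%N = 'C(#|G|, k).
Proof.
move=> co_k; rewrite -card_draws.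
pose shift (x : G) (A : {set G}) := [set g + x | g in A].
rewrite (card_eq_shift (w := fun A : {set G} => \sum_(g in A) g) (shift := shift) co_k).
- by congr (_ * _)%N; apply: eq_card => A; rewrite !inE.
- by move=> x; apply: imset_inj; apply: addIr.
- by move=> x A; rewrite !inE card_imset //; apply: addIr.
move=> x A; rewrite inE => /eqP <-.
rewrite big_imset /=; last by move=> ? ? _ _ /addIr.
by rewrite big_split /= sumr_const.
Qed.

(** * Dyck paths and the cycle lemma *)

(** This is [a] times the signed vertical distance from the endpoint to the diagonal, which keeps it
    an integer. *)
Definition height (a b : nat) (s : seq bool) : int :=
  (a * count_mem true s)%:Z - (b * count_mem false s)%:Z.

Lemma height_cat (a b : nat) (s t : seq bool) :
  height a b (s ++ t) = height a b s + height a b t.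
Proof. by rewrite /height !count_cat !mulnDr; lia. Qed.

Lemma count_true_false (s : seq bool) :
  (count_mem false s + count_mem true s)%N = size s.
Proof.
by rewrite -(count_predC (pred1 true)) addnC; congr addn; apply: eq_count => -[].
Qed.

(* Modulo a + b, each of the two kinds of steps raises the height by a. *)
Lemma height_congr (a b : nat) (s t : seq bool) :
  height a b s = height a b t -> (a * size s = a * size t %[mod a + b])%N.
Proof.
rewrite /height -!count_true_false; move=> hst.
rewrite -(modnMDl (count_mem false t)) -[RHS](modnMDl (count_mem false s)).
congr (_ %% _)%N; nia.
Qed.

Lemma DyckP (a b : nat) (p : (a + b).-tuple bool) : (0 < a)%N ->
  reflect (count_mem true p = b /\
           forall i, (i <= a + b)%N -> 0 <= height a b (take i p))
          (p \in Dyck a b).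
Proof.
move=> a_gt0; have Dsub i : (b%:R / a%:R * (count_mem false (take i p))%:R
    <= (count_mem true (take i p))%:R :> rat) = (0 <= height a b (take i p)).
  rewrite mulrAC ler_pdivrMr ?ltr0n // -!natrM ler_nat /height subr_ge0 lez_nat.
  by rewrite [(count_mem true _ * _)%N]mulnC.
rewrite inE; apply: (iffP andP) => [[/eqP[pa pb] /forallP Dp]|[pb Dp]].
  by split=> // i lei; have := Dp (Ordinal (lei : i < (a + b).+1)%N); rewrite /= Dsub.
split.
  have := count_true_false p; rewrite size_tuple /endpoint pb => /eqP.
  rewrite eqn_add2r => /eqP->.
  by rewrite eqxx.
by apply/forallP => i /=; rewrite Dsub Dp // -ltnS.
Qed.

Lemma card_words (a b : nat) :
  #|[set p : (a + b).-tuple bool | count_mem true p == b]| = 'C(a + b, a).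
Proof.
pose f (p : (a + b).-tuple bool) := [set i | tnth p i].
have f_inj : injective f.
  by move=> p q /setP fpq; apply: eq_from_tnth => i; have := fpq i; rewrite !inE.
have card_f p : #|f p| = count_mem true p.
  rewrite -sum1_card -sum1_count big_tuple; apply: eq_bigl => i.
  by rewrite inE; case: (tnth p i).
rewrite -[RHS]bin_sub ?leq_addr // addKn.
rewrite -['C(_, _)](congr1 (binomial^~ b) (card_ord (a + b))) -card_draws.
rewrite -(card_imset _ f_inj); apply: eq_card => A; apply/imsetP/idP.
  by case=> p + ->; rewrite !inE card_f.
rewrite inE => A_b.
have fK : f [tuple i \in A | i < a + b] = A.
  by apply/setP => i; rewrite inE tnth_mktuple.
by exists [tuple i \in A | i < a + b]; rewrite ?inE -?card_f fK.
Qed.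

(** The whole word has height 0, so the prefixes of its rotation by [i] have the heights of the
    prefixes of [p], in cyclic order, minus the height of [take i p]. *)
Lemma rot_DyckP (a b : nat) (p : (a + b).-tuple bool) (i : nat) :
    (0 < a)%N -> count_mem true p = b -> (i < a + b)%N ->
  reflect (forall j, (j < a + b)%N -> height a b (take i p) <= height a b (take j p))
          ([tuple of rot i p] \in Dyck a b).
Proof.
move=> a_gt0 pb lti; have szp := size_tuple p.
have hp : height a b p = 0.
  have := count_true_false p; rewrite szp /height pb => /eqP; rewrite eqn_add2r => /eqP->.
  by rewrite mulnC subrr.
have h_drop : height a b (drop i p) = - height a b (take i p).
  by apply/eqP; rewrite -addr_eq0 addrC -height_cat cat_take_drop hp.
apply: (iffP (DyckP _ a_gt0)) => [[_ Dp] j ltj|min_i].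
  have [le_ij|lt_ji] := leqP i j.
    have := Dp (j - i)%N (leq_trans (leq_subr _ _) (ltnW ltj)).
    rewrite /= /rot takel_cat ?size_drop ?szp ?leq_sub2r 1?ltnW //.
    by rewrite -[in take j p](subnKC le_ij) takeD height_cat lerDl.
  have := Dp (size (drop i p) + j)%N.
  rewrite /= /rot takeD take_size_cat // drop_size_cat // height_cat h_drop.
  rewrite (take_takel _ (ltnW lt_ji)) addrC subr_ge0; apply.
  by rewrite size_drop szp; lia.
split=> [|j lej]; first by rewrite -[RHS]pb; apply/permP; rewrite perm_rot.
rewrite /= /rot; have [le_j|lt_j] := leqP j (size (drop i p)).
  rewrite takel_cat //; move: le_j; rewrite size_drop szp => le_j.
  have hD : height a b (take (i + j) p) =
      height a b (take i p) + height a b (take j (drop i p)).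
    by rewrite takeD height_cat.
  have [/min_i|ge_ij] := ltnP (i + j) (a + b); first by rewrite hD lerDl.
  have := min_i 0%N; rewrite take0 => /(_ (leq_ltn_trans (leq0n _) lti)) h_i.
  rewrite take_oversize ?h_drop ?oppr_ge0; last by rewrite size_drop szp; lia.
  by rewrite /height /= !muln0 subrr in h_i.
rewrite take_cat ltnNge ltnW //= height_cat h_drop addrC subr_ge0.
move: lt_j; rewrite size_drop szp => lt_j.
rewrite take_takel; last by lia.
by apply: min_i; lia.
Qed.

Lemma cycle_lemma (a b : nat) (p : (a + b).-tuple bool) :
    (0 < a)%N -> coprime a b -> count_mem true p = b ->
  #|[set i : 'I_(a + b) | [tuple of rot i p] \in Dyck a b]| = 1%N.
Proof.
move=> a_gt0 co_ab pb; have N_gt0 : (0 < a + b)%N by rewrite addn_gt0 a_gt0.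
pose h (i : 'I_(a + b)) := height a b (take i p).
have h_inj : injective h.
  move=> i j /height_congr; rewrite !size_takel ?size_tuple 1?ltnW // => /eqP.
  wlog le_ij : i j / (i <= j)%N => [W|].
    by have [/W|/ltnW/W {}W] := leqP i j; [apply | rewrite eq_sym => /W].
  rewrite eq_sym eqn_mod_dvd ?leq_mul2l ?le_ij ?orbT // -mulnBr.
  (* Since [a] is prime to [a + b], the modulus [a + b] divides [j - i], which is smaller. *)
  rewrite Gauss_dvdr; last by rewrite coprime_sym /coprime gcdnDl.
  have lt_N : (j - i < a + b)%N by rewrite (leq_ltn_trans (leq_subr _ _)).
  have [/eqP ij _|ij_gt0] := posnP (j - i); last by rewrite gtnNdvd.
  by apply/val_inj/anti_leq; rewrite le_ij -subn_eq0.
have [i0 _ min_i0] := @arg_minP _ _ 'I_(a + b) (Ordinal N_gt0) predT h isT.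
apply/eqP/cards1P; exists i0; apply/setP => i; rewrite in_set in_set1.
apply/idP/eqP => [/(rot_DyckP a_gt0 pb (ltn_ord i)) min_i|->].
  apply: h_inj; apply: le_anti; rewrite min_i0 // andbT.
  exact: min_i.
by apply/(rot_DyckP a_gt0 pb (ltn_ord i0)) => j ltj; apply: (min_i0 (Ordinal ltj)).
Qed.

(** Double counting of the pairs of a word and a rotation making it a Dyck path: each word has one
    such rotation, and each of the [a + b] rotations permutes the words. *)
Lemma card_Dyck (a b : nat) : (0 < a)%N -> coprime a b ->
  ((a + b) * #|Dyck a b|)%N = 'C(a + b, a).
Proof.
move=> a_gt0 co_ab; rewrite -card_words; set W := [set p | _].
pose rotp i (p : (a + b).-tuple bool) := [tuple of rot i p].
transitivity (\sum_(p in W) \sum_(i < a + b | rotp i p \in Dyck a b) 1)%N.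
  rewrite (exchange_big_dep predT) //= -[X in (X * _)%N]card_ord -sum_nat_const.
  apply: eq_bigr => i _; rewrite sum1dep_card.
  have rot_inj : injective (rotp i).
    by move=> p q /(congr1 val)/rot_inj/val_inj.
  have [irot rotK irotK] := injF_bij rot_inj.
  rewrite -(card_imset _ rot_inj); apply: eq_card => p; apply/idP/imsetP.
    move=> Dp; exists (irot p); rewrite ?irotK // inE irotK Dp andbT inE.
    have /DyckP[//|pb _] := Dp; rewrite -[X in _ == X]pb; apply/eqP.
    by rewrite -[in RHS](irotK p) /=; apply/permP; rewrite perm_sym perm_rot.
  by case=> q + ->; rewrite inE => /andP[].
rewrite -[RHS]sum1_card; apply: eq_bigr => p; rewrite inE => /eqP pb.
by rewrite sum1dep_card cycle_lemma.
Qed.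

(** * Generating functions modulo a power of X *)

(** Expanding the product chooses an exponent [f t] in every factor. Truncation at degree [m] leaves
    this coefficient unchanged and stays within polynomials. *)
Lemma coef_prod_geometric (T : finType) (R : comNzRingType) (a : T -> R) (m : nat) :
  (\prod_t \sum_(i < m.+1) (a t *: 'X) ^+ i : {poly R})`_m =
  \sum_(f in mults T m) \prod_t a t ^+ f t.
Proof.
rewrite bigA_distr_bigA coef_sum [RHS]big_mkcond /=; apply: eq_bigr => f _.
under eq_bigr do rewrite exprZn.
rewrite scaler_prod prodrXr coefZ coefXn inE eq_sym.
by case: eqP; rewrite (mulr1, mulr0).
Qed.

Lemma geometric_sum (R : pzRingType) (x : R) (k : nat) :
  (\sum_(i < k) x ^+ i) * (1 - x) = 1 - x ^+ k.
Proof.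
elim: k => [|k IHk]; first by rewrite big_ord0 mul0r expr0 subrr.
by rewrite big_ord_recr /= mulrDl IHk mulrBr mulr1 -exprSr addrA subrK.
Qed.

Lemma prod_1BXn (R : comNzRingType) (m : nat) (T : finType) (F : T -> {poly R}) :
    (forall t, exists q, F t = 1 - 'X^m * q) ->
  exists q, \prod_t F t = 1 - 'X^m * q.
Proof.
move=> F1; elim/big_ind: _ => [|p p' [q ->] [q' ->]|t _]; last exact: F1.
  by exists 0; rewrite mulr0 subr0.
exists (q + q' - q * ('X^m * q')); rewrite mulrBl mul1r mulrBr mulrDr -mulrA; ring.
Qed.

(** Inverses of [D] modulo ['X^(m.+1)] are unique; this stands in for division of power series. *)
Lemma coef_inv_mod_Xn (R : comNzRingType) (m : nat) (D E E' q q' : {poly R}) :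
    E * D = 1 - 'X^(m.+1) * q -> E' * D = 1 - 'X^(m.+1) * q' -> E`_m = E'`_m.
Proof.
move=> ED E'D; apply/eqP; rewrite -subr_eq0 -coefB.
have -> : E - E' = 'X^(m.+1) * (E * q' - E' * q).
  have: E * (1 - E' * D) - E' * (1 - E * D) = E - E' by ring.
  by rewrite ED E'D => <-; ring.
by rewrite coefXnM ltnSn.
Qed.

(** The left side is a coefficient of one inverse of [(1 - 'X^o) ^+ k] modulo ['X^(m.+1)]. A second
    inverse is a product of [k] truncated geometric series in ['X^o], whose coefficient counts
    multisets of size [m %/ o] on [k] letters. *)
Lemma sum_mults_prod (R : comNzRingType) (T : finType) (a : T -> R) (o k m : nat) :
    (0 < o)%N -> (0 < k)%N ->
    \prod_t (1 - a t *: 'X) = (1 - 'X^o) ^+ k ->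
  \sum_(f in mults T m) \prod_t a t ^+ f t =
  if (o %| m)%N then 'C(k.-1 + m %/ o, m %/ o)%:R else 0.
Proof.
move=> o_gt0 k_gt0 aE; rewrite -coef_prod_geometric.
have [q Dq] : exists q, (\prod_t \sum_(i < m.+1) (a t *: 'X) ^+ i) *
    (1 - 'X^o) ^+ k = 1 - 'X^(m.+1) * q.
  rewrite -aE -big_split /=; apply: prod_1BXn => t; rewrite geometric_sum.
  by exists (a t ^+ m.+1)%:P; rewrite exprZn mulrC mul_polyC.
(* The factor [1 *:] gives [g] the shape required by [coef_prod_geometric]. *)
pose g : {poly R} := \prod_(j < k) \sum_(i < (m %/ o).+1) (1 *: 'X) ^+ i.
have [q' Dq'] : exists q, (g \Po 'X^o) * (1 - 'X^o) ^+ k = 1 - 'X^(m.+1) * q.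
  have -> : (1 - 'X^o) ^+ k = \prod_(j < k) (1 - 'X^o) :> {poly R}.
    by rewrite prodr_const card_ord.
  rewrite /g rmorph_prod -big_split /=.
  apply: prod_1BXn => j; rewrite raddf_sum /=.
  under eq_bigr do rewrite scale1r comp_Xn_poly.
  (* The truncation error has degree [(m %/ o).+1 * o], which exceeds [m]. *)
  rewrite geometric_sum -exprM mulnC; exists 'X^((m %/ o).+1 * o - m.+1).
  by rewrite -exprD subnKC // ltn_ceil.
rewrite (coef_inv_mod_Xn Dq Dq') coef_comp_poly_Xn //; case: ifP => // _.
rewrite coef_prod_geometric; rewrite (eq_bigr (fun=> 1)) => [|f _].
  by rewrite sumr_const card_mults card_ord.
by rewrite big1 // => t _; rewrite expr1n.
Qed.

(** * Pairings and orthogonality *)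

(** A nondegenerate bicharacter; symmetry yields multiplicativity in the second argument. *)
Definition perfect_pairing (G : finZmodType) (F : fieldType) (p : G -> G -> F) : Prop :=
  [/\ forall y, p 0 y = 1,
      forall g h y, p (g + h) y = p g y * p h y,
      forall g y, p g y = p y g
    & forall y, (forall g, p g y = 1) -> y = 0].

Lemma pairingMn (G : finZmodType) (F : fieldType) (p : G -> G -> F) g y e :
  perfect_pairing p -> p (g *+ e) y = p g y ^+ e.
Proof.
case=> p0 pD _ _; elim: e => [|e IHe]; first by rewrite mulr0n p0.
by rewrite mulrSr pD IHe exprSr.
Qed.

Lemma pairing_neq0 (G : finZmodType) (F : fieldType) (p : G -> G -> F) g y :
  perfect_pairing p -> p g y != 0.
Proof.
case=> p0 pD _ _; apply/eqP => pg0; have := p0 y.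
by rewrite -(subrr g) pD pg0 mul0r => /esym/eqP; rewrite oner_eq0.
Qed.

(** For [g != 0] some [p h g] differs from 1, and translating [y] by [h] multiplies the sum by
    it. *)
Lemma pairing_sum (G : finZmodType) (F : fieldType) (p : G -> G -> F) (g : G) :
  perfect_pairing p -> \sum_y p g y = (#|G| * (g == 0))%:R.
Proof.
move=> pp; have [p0 pD pC pN] := pp; case: eqVneq => [->|g_neq0].
  by rewrite (eq_bigr (fun=> 1)) // sumr_const muln1.
rewrite muln0; have [h ph] : exists h, p h g != 1.
  apply/existsP; apply: contra_neqT g_neq0; rewrite negb_exists => /forallP p1.
  by apply: pN => h; apply/eqP; have := p1 h; rewrite negbK.
apply/eqP; have: (p h g - 1) * \sum_y p g y == 0.
  rewrite mulrBl mul1r mulr_sumr subr_eq0; apply/eqP.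
  rewrite [RHS](reindex_inj (addrI h)) /=; apply: eq_bigr => y _.
  by rewrite ![p g _]pC pD.
by rewrite mulf_eq0 subr_eq0 (negPf ph).
Qed.

Lemma wsum_pairing (G : finZmodType) (F : fieldType) (p : G -> G -> F) y m
    (f : {ffun G -> 'I_m.+1}) : perfect_pairing p ->
  p (wsum f) y = \prod_g p g y ^+ f g.
Proof.
move=> pp; have [p0 pD _ _] := pp.
rewrite /wsum (big_morph (p^~ y) (fun g h => pD g h y) (p0 y)).
by apply: eq_bigr => g _; rewrite pairingMn.
Qed.

Lemma size_prod_1BX (R : nzRingType) (s : seq R) :
  (size (\prod_(z <- s) (1 - z *: 'X : {poly R}))%R <= (size s).+1)%N.
Proof.
elim: s => [|z s IHs]; first by rewrite big_nil size_poly1.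
rewrite big_cons (leq_trans (size_polyMleq _ _)) //.
have size2 : (size (1 - z *: 'X : {poly R})%R <= 2)%N.
  rewrite (leq_trans (size_polyD _ _)) // geq_max size_poly1 size_polyN.
  by rewrite (leq_trans (size_scale_leq _ _)) ?size_polyX.
by rewrite /= -[(size s).+2]/(2 + (size s).+1).-1 -!subn1 leq_sub2r // leq_add.
Qed.

(** The values [p g y] run through all roots of unity of order dividing that of [y], each taken
    equally often, and [1 - 'X^o] is the product of [1 - z *: 'X] over the [o]-th roots of unity
    [z]. *)
Lemma prod_1BpairingX (G : finZmodType) (F : fieldType) (p : G -> G -> F) (y : G) :
    perfect_pairing p ->
  \prod_g (1 - p g y *: 'X) = (1 - 'X^(#[y]%g)) ^+ (#|G| %/ #[y]%g) :> {poly F}.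
Proof.
move=> pp; have [p0 pD pC pN] := pp.
pose c := [seq p g y | g <- enum G]; pose s := undup c.
have s_uniq : uniq s by apply: undup_uniq.
have mem_s g : p g y \in s by rewrite mem_undup map_f ?mem_enum.
have sP z : z \in s -> exists g, z = p g y.
  by rewrite mem_undup => /mapP[g _ ->]; exists g.
have y_order e : (#[y]%g %| e)%N = (y *+ e == 0) by rewrite order_dvdn FinRing.zmodXgE.
have mulrn0 e : (forall g, p g y ^+ e = 1) -> (#[y]%g %| e)%N.
  move=> pe; rewrite y_order; apply/eqP/pN => g.
  by rewrite pC pairingMn // pC pe.
have p_order g : p g y ^+ #[y]%g = 1.
  have := dvdnn #[y]%g; rewrite y_order => /eqP yo.
  by rewrite pC -pairingMn // yo p0.
have o_gt0 : (0 < #[y]%g)%N by apply: order_gt0.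
(* The values of p^~ y are roots of unity of order dividing that of y; multiplying
   all of them by one of them permutes them, so their number kills y. *)
have size_s : size s = #[y]%g.
  apply/eqP; rewrite eqn_leq; apply/andP; split.
    apply: max_unity_roots => //; apply/allP => z /sP[g ->].
    by apply/unity_rootP/p_order.
  apply: dvdn_leq.
    by have := mem_s 0; case: (s).
  apply: mulrn0 => g; set z := p g y.
  have z_neq0 : z != 0 by apply: pairing_neq0.
  have perm_zs : perm_eq [seq z * w | w <- s] s.
    have zs_uniq : uniq [seq z * w | w <- s].
      by rewrite map_inj_uniq //; apply: mulfI.
    have [||_ eq_zs] := uniq_min_size zs_uniq (s2 := s); last exact: uniq_perm.
      by move=> _ /mapP[w /sP[h ->] ->]; rewrite -pD.
    by rewrite size_map.
  have prod_neq0 : \prod_(w <- s) w != 0.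
    by rewrite prodf_seq_neq0; apply/allP => w /sP[h ->]; rewrite pairing_neq0.
  apply: (mulIf prod_neq0); rewrite mul1r -[in RHS](perm_big _ perm_zs) big_map /=.
  rewrite big_split /=; congr (_ * _).
  by rewrite big_const_seq count_predT iter_mulr_1.
pose K := #|[set g | p g y == 1]|.
(* Adding [h] carries the kernel of [p^~ y] onto the fibre over [p h y]. *)
have count_c z : z \in s -> count_mem z c = K.
  move=> /sP[h ->]; rewrite -sum1_count big_map big_enum_cond sum1dep_card /K.
  rewrite -[RHS](card_imset _ (addIr h)); apply: eq_card => g; apply/idP/imsetP.
    rewrite inE => /eqP pg; exists (g - h); last by rewrite subrK.
    rewrite inE -(inj_eq (mulIf (pairing_neq0 h y pp))) -pD subrK mul1r.
    exact/eqP.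
  by case=> x; rewrite inE => /eqP px ->; rewrite inE pD px mul1r /= eqxx.
have -> : (#|G| %/ #[y]%g)%N = K.
  rewrite cardE -(size_map (p^~ y)) -/c -sum1_size.
  rewrite -(big_undup_iterop_count addn) -/s (eq_big_seq (fun=> K)) => [|z sz].
    by rewrite big_const_seq count_predT iter_addn_0 size_s mulnK.
  by rewrite count_c // Monoid.iteropE iter_addn_0 mul1n.
have -> : \prod_g (1 - p g y *: 'X) = (\prod_(z <- s) (1 - z *: 'X)) ^+ K :> {poly F}.
  rewrite -prodrXl -big_enum -(big_map (p^~ y) predT (fun z => 1 - z *: 'X)) -/c.
  by rewrite -(prodr_undup_exp_count c); apply: eq_big_seq => z sz; rewrite count_c.
congr (_ ^+ _); apply/eqP; rewrite -subr_eq0; set q := _ - _.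
(* Both sides have degree at most #[y] and agree at 0 and at the #[y] values in s. *)
have s0_uniq : uniq (0 :: s).
  rewrite /= s_uniq andbT; apply/negP => /sP[g]/esym/eqP.
  by rewrite (negPf (pairing_neq0 _ _ pp)).
have hornerq x : q.[x] = \prod_(z <- s) (1 - z * x) - (1 - x ^+ #[y]%g).
  rewrite /q !hornerE horner_prod; congr (_ - _).
  by apply: eq_bigr => z _; rewrite !hornerE.
have q_roots : all (root q) (0 :: s).
  apply/allP => x; rewrite inE => /predU1P[->|/sP[g ->]]; apply/rootP; rewrite hornerq.
    rewrite expr0n eqn0Ngt o_gt0 subr0 big1 ?subrr // => z _.
    by rewrite mulr0 subr0.
  rewrite p_order subrr subr0; apply/eqP; rewrite prodf_seq_eq0; apply/hasP.
  (* The factor indexed by the inverse of [p g y] vanishes at [p g y]. *)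
  by exists (p (- g) y) => //=; rewrite -pD addNr p0 subrr.
apply: contraT => q_neq0.
have := max_poly_roots q_neq0 q_roots s0_uniq.
rewrite ltnNge (leq_trans (size_polyD _ _)) // geq_max size_polyN.
rewrite size_prod_1BX /= size_s (leq_trans (size_polyD _ _)) // geq_max size_polyN.
by rewrite size_polyXn size_poly1 leqnn.
Qed.

Lemma card_zsM_pairing (G : finZmodType) (p : G -> G -> algC) (m : nat) :
    perfect_pairing p ->
  ((#|G| + m) * #|` zsM G m|%fset)%N =
  (\sum_(y : G | #[y]%g %| m)
     'C((#|G| + m) %/ #[y]%g, #|G| %/ #[y]%g))%N.
Proof.
move=> pp; have G_gt0 : (0 < #|G|)%N by apply/card_gt0P; exists 0.
have o_dvd (y : G) : (#[y]%g %| #|G|)%N by rewrite -cardsT order_dvdG ?inE.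
(* Orthogonality detects zero sums; after exchanging summations, each [y] contributes one
   coefficient of the generating function. *)
have count_sum : (#|G| * #|` zsM G m|%fset)%N =
    (\sum_(y : G | #[y]%g %| m) 'C((#|G| %/ #[y]%g).-1 + m %/ #[y]%g, m %/ #[y]%g))%N.
  apply/eqP; rewrite -(eqr_nat algC) natr_sum natrM; apply/eqP.
  transitivity (\sum_y \sum_(f in mults G m) p (wsum f) y).
    rewrite exchange_big /= card_zsM -sum1_card natr_sum mulr_sumr [LHS]big_mkcond.
    rewrite [RHS]big_mkcond /=; apply: eq_bigr => f _; rewrite inE.
    case: (f \in _) => //=; rewrite pairing_sum //.
    by case: (wsum f == 0); rewrite ?muln0 // muln1 mulr1.
  rewrite [RHS]big_mkcond; apply: eq_bigr => y _.
  under eq_bigr do rewrite wsum_pairing //.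
  rewrite (sum_mults_prod m _ _ (prod_1BpairingX y pp)) ?order_gt0 //.
  by rewrite divn_gt0 ?order_gt0 // dvdn_leq.
(* The absorption identity [mul_bin_pred_add] now applies to each term, once the common factor [o]
   of [#|G|] and [m] is split off. *)
apply/eqP; rewrite -(eqn_pmul2l G_gt0) mulnCA count_sum !big_distrr /=; apply/eqP.
apply: eq_bigr => y o_m; set o := #[y]%g; set a := (#|G| %/ o)%N; set b := (m %/ o)%N.
have GE : #|G| = (a * o)%N by rewrite /a divnK ?o_dvd.
have mE : m = (b * o)%N by rewrite /b divnK.
have a_gt0 : (0 < a)%N by move: G_gt0; rewrite GE muln_gt0 => /andP[].
rewrite divnDl ?o_dvd // -/a -/b; clearbody a b; rewrite GE {1}mE -mulnDl.
by rewrite mulnAC mul_bin_pred_add // mulnAC.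
Qed.

(** * Pairing, exponent and torsion of powers of cyclic groups *)

(** The pairing raises a primitive [n]-th root of unity to the dot product of the coordinates. *)
Lemma isoCr_pairing (G : finZmodType) (n r : nat) : (0 < n)%N ->
  isoCr G n r -> exists p : G -> G -> algC, perfect_pairing p.
Proof.
case: n => // n _ [f [f' fK f'K]]; have [w w_prim] := C_prim_root_exists (ltn0Sn n).
exists (fun g y => \prod_i (w ^+ f g i) ^+ f y i); split.
- by move=> y; rewrite raddf0; apply: big1 => i _; rewrite ffunE expr0 expr1n.
- move=> g h y; rewrite raddfD -big_split /=; apply: eq_bigr => i _.
  by rewrite ffunE /= (prim_expr_mod w_prim) exprD exprMn.
- by move=> g y; apply: eq_bigr => i _; rewrite exprAC.
move=> y p1; apply: (can_inj fK); rewrite raddf0; apply/ffunP => i; rewrite ffunE.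
(* Pairing with the [i]-th basis vector isolates the [i]-th coordinate of [y]; [inZp 1] is 1 reduced
   modulo [n], which also covers [n = 1]. *)
have := p1 (f' [ffun j => if j == i then inZp 1 else 0]); rewrite f'K.
rewrite (bigD1 i) //= big1 ?mulr1 => [|j /negPf ij]; last first.
  by rewrite ffunE ij expr0 expr1n.
rewrite ffunE eqxx /= (prim_expr_mod w_prim) expr1 => /eqP.
rewrite -(prim_order_dvd w_prim) => n_dvd; apply: val_inj => /=.
by apply/eqP; move: n_dvd; rewrite /dvdn modn_small ?ltn_ord.
Qed.

Lemma isoCr_exponent (G : finZmodType) (n r : nat) (y : G) : (0 < n)%N ->
  isoCr G n r -> (#[y]%g %| n)%N.
Proof.
case: n => // n _ [f [f' fK f'K]]; rewrite order_dvdn FinRing.zmodXgE; apply/eqP.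
apply: (can_inj fK); rewrite raddf0 raddfMn; apply/ffunP => i.
by rewrite ffunMnE ffunE Zp_mulrn; apply: val_inj; rewrite /= modnMl.
Qed.

Lemma isoCr_card (G : finZmodType) (n r : nat) : (0 < n)%N ->
  isoCr G n r -> #|G| = (n ^ r)%N.
Proof.
by case: n => // n _ [f /bij_eq_card->]; rewrite card_ffun !card_ord.
Qed.

(** With [n.+1 = q * d], the elements killed by [d] are the [i * q] for [i < d]. *)
Lemma card_Zp_torsion (n d : nat) : (d %| n.+1)%N ->
  #|[set j : 'I_n.+1 | j *+ d == 0]| = d.
Proof.
case/dvdnP => q nE; have [q_gt0 d_gt0] : (0 < q /\ 0 < d)%N.
  by apply/andP; rewrite -muln_gt0 -nE.
have lt_qn (i : 'I_d) : (i * q < n.+1)%N by rewrite nE mulnC ltn_pmul2l.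
have f_inj : injective (fun i => Ordinal (lt_qn i)).
  by move=> i j [] /eqP; rewrite eqn_pmul2r // => /eqP/val_inj.
rewrite -[RHS]card_ord -cardsT -(card_imset _ f_inj).
apply: eq_card => j; rewrite inE Zp_mulrn -val_eqE /= -[_ == _]/(n.+1 %| j * d)%N.
have -> : (n.+1 %| j * d)%N = (q %| j)%N by rewrite -[RHS](dvdn_pmul2r d_gt0) -nE.
apply/idP/imsetP => [/dvdnP[i jE]|[i _ ->]].
  have lt_id : (i < d)%N.
    by rewrite -(ltn_pmul2r q_gt0) -jE mulnC -nE ltn_ord.
  by exists (Ordinal lt_id) => //; apply: val_inj.
exact: dvdn_mull.
Qed.

Lemma isoCr_card_torsion (G : finZmodType) (n r d : nat) : (0 < n)%N ->
  isoCr G n r -> (d %| n)%N -> #|[set y : G | (#[y]%g %| d)%N]| = (d ^ r)%N.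
Proof.
case: n => // n _ [f f_bij] d_n; have f_inj := bij_inj f_bij; have [f' fK f'K] := f_bij.
rewrite -(card_imset _ f_inj) -[d in RHS](card_Zp_torsion d_n) -[r in RHS]card_ord.
rewrite -card_ffun_on; apply: eq_card => x; apply/imsetP/ffun_onP.
  case=> y + -> i; rewrite !inE order_dvdn FinRing.zmodXgE => /eqP yd.
  by rewrite -ffunMnE -raddfMn yd raddf0 ffunE.
move=> xd; exists (f' x); rewrite ?f'K // inE order_dvdn FinRing.zmodXgE.
apply/eqP/f_inj; rewrite raddfMn raddf0 f'K; apply/ffunP => i.
by rewrite ffunMnE ffunE; have := xd i; rewrite inE => /eqP.
Qed.

Lemma sum_by_order (G : finZmodType) (F : nat -> nat) (e : nat) : (0 < e)%N ->
  (\sum_(y : G | #[y]%g %| e) F #[y]%g =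
   \sum_(d < e.+1 | d %| e) #|[set y : G | #[y]%g == d]| * F d)%N.
Proof.
move=> e_gt0; have le_e (y : G) : (#[y]%g %| e)%N -> (#[y]%g < e.+1)%N.
  by move=> ?; rewrite ltnS dvdn_leq.
rewrite (partition_big (fun y : G => inord #[y]%g : 'I_e.+1)
                       (fun d : 'I_e.+1 => d %| e)%N) /= => [|y y_e]; last by rewrite inordK ?le_e.
apply: eq_bigr => d d_e; rewrite -sum_nat_const; apply: eq_big => y.
  rewrite inE; apply/andP/eqP => [[y_e /eqP <-]|->]; first by rewrite inordK ?le_e.
  by rewrite d_e inord_val.
by move=> /andP[y_e /eqP <-]; rewrite inordK ?le_e.
Qed.

(** Both groups have [d ^ r] elements killed by [d]; by strong induction the elements of smaller
    order dividing [d] are equally numerous, and subtracting them leaves order exactly [d]. *)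
Lemma isoCr_card_order (G H : finZmodType) (n m r d : nat) :
    (0 < n)%N -> (0 < m)%N -> isoCr G n r -> isoCr H m r ->
    (d %| n)%N -> (d %| m)%N ->
  #|[set y : G | #[y]%g == d]| = #|[set y : H | #[y]%g == d]|.
Proof.
move=> n_gt0 m_gt0 isoG isoH; elim/ltn_ind: d => d IHd d_n d_m.
have d_gt0 := dvdn_gt0 n_gt0 d_n.
have torsionE (K : finZmodType) : #|[set y : K | (#[y]%g %| d)%N]| =
    (\sum_(e < d | e %| d) #|[set y : K | #[y]%g == e]| + #|[set y : K | #[y]%g == d]|)%N.
  rewrite -sum1dep_card (sum_by_order K (fun=> 1%N) d_gt0) big_mkcond big_ord_recr /=.
  rewrite dvdnn muln1 [in RHS]big_mkcond; congr addn.
  by apply: eq_bigr => e _; rewrite muln1.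
apply: (@addnI (\sum_(e < d | e %| d) #|[set y : G | #[y]%g == e]|)%N).
rewrite -torsionE (isoCr_card_torsion n_gt0 isoG d_n).
rewrite -(isoCr_card_torsion m_gt0 isoH d_m) torsionE; congr addn.
apply: eq_bigr => e e_d; symmetry.
by apply: IHd; rewrite ?(dvdn_trans e_d) // ltn_ord.
Qed.

(** * Symmetry of the count for powers of cyclic groups *)

Lemma card_zsM_isoCr (G H : finZmodType) (n m r : nat) :
    (0 < n)%N -> (0 < m)%N -> isoCr G n r -> isoCr H m r ->
    gcdn n (m ^ r) = gcdn (n ^ r) m ->
  #|` zsM G #|H| |%fset = #|` zsM H #|G| |%fset.
Proof.
move=> n_gt0 m_gt0 isoG isoH gcdE.
have [p pp] := isoCr_pairing n_gt0 isoG; have [q qq] := isoCr_pairing m_gt0 isoH.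
have cG := isoCr_card n_gt0 isoG; have cH := isoCr_card m_gt0 isoH.
have GH_gt0 : (0 < #|G| + #|H|)%N by rewrite cG addn_gt0 expn_gt0 n_gt0.
pose e := gcdn n (m ^ r).
have e_gt0 : (0 < e)%N by rewrite gcdn_gt0 n_gt0.
have e_n : (e %| n)%N by apply: dvdn_gcdl.
have e_m : (e %| m)%N by rewrite /e gcdE dvdn_gcdr.
have e_G : (e %| #|G|)%N by rewrite cG /e gcdE dvdn_gcdl.
have e_H : (e %| #|H|)%N by rewrite cH dvdn_gcdr.
apply/eqP; rewrite -(eqn_pmul2l GH_gt0) (card_zsM_pairing _ pp).
rewrite [X in _ == (X * _)%N]addnC (card_zsM_pairing _ qq); apply/eqP.
(* Orders in [G] divide [n], so those dividing [#|H|] are exactly those dividing [e]; the gcd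
   hypothesis gives the same [e] for [H]. *)
under eq_bigl => y do
  rewrite cH -[(_ %| _)%N]andTb -(isoCr_exponent y n_gt0 isoG) -dvdn_gcd -/e.
under [RHS]eq_bigl => y do
  rewrite cG -[(_ %| _)%N]andbT -(isoCr_exponent y m_gt0 isoH) -dvdn_gcd -gcdE -/e.
rewrite (sum_by_order G (fun d => 'C((#|G| + #|H|) %/ d, #|G| %/ d)) e_gt0).
rewrite (sum_by_order H (fun d => 'C((#|H| + #|G|) %/ d, #|H| %/ d)) e_gt0).
apply: eq_bigr => d d_e.
rewrite (isoCr_card_order n_gt0 m_gt0 isoG isoH) ?(dvdn_trans d_e) //.
congr (_ * _)%N; rewrite addnC !divnDl ?(dvdn_trans d_e) //.
by rewrite -[RHS]bin_sub ?leq_addr // addKn.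
Qed.

(** * Assembly of the three claims *)

Lemma natr_eq_div (a b c : nat) :
  (0 < a)%N -> (a * b)%N = c -> b%:R = a%:R^-1 * c%:R :> rat.
Proof. by move=> a_gt0 <-; rewrite natrM mulKf // pnatr_eq0 -lt0n. Qed.

Theorem theorem1p1 (k m n r : nat)
    (k_gt0 : (0 < k)%N) (m_gt0 : (0 < m)%N) (n_gt0 : (0 < n)%N)
    (r_gt0 : (0 < r)%N) (G H : finZmodType) :
  [/\ coprime #|G| #|H| ->
      [/\ in_bijection (mem (zsM G #|H|)) (mem (zsM H #|G|)),
          in_bijection (mem (zsM H #|G|)) (mem (Dyck #|G| #|H|)),
          in_bijection (mem (zsM G #|H|)) (mem (Dyck #|G| #|H|)),
          #|` zsM G #|H| |%fset = #|` zsM H #|G| |%fset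
        & #|` zsM H #|G| |%fset%:R = Cat #|G| #|H| ],

      isoCr G n r -> isoCr H m r -> gcdn n (m ^ r) = gcdn (n ^ r) m ->
      #|` zsM G #|H| |%fset = #|` zsM H #|G| |%fset

    & (k < #|G|)%N -> coprime k #|G| ->
      [/\ in_bijection (mem (zsN G k)) (mem (zsN G (#|G| - k))),
          in_bijection (mem (zsN G (#|G| - k))) (mem (Dyck k (#|G| - k))),
          in_bijection (mem (zsN G k)) (mem (Dyck k (#|G| - k)))
        & [/\ #|zsN G k| = #|zsN G (#|G| - k)|,
              #|zsN G (#|G| - k)|%:R = #|G|%:R^-1 * 'C(#|G|, k)%:R :> rat
            & #|G|%:R^-1 * 'C(#|G|, k)%:R = Cat k (#|G| - k) ]]].
Proof.
have G_gt0 : (0 < #|G|)%N by apply/card_gt0P; exists 0.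
split=> [co_GH| |lt_kG co_kG]; last 1 first.
- have le_kG := ltnW lt_kG; have cardG : (k + (#|G| - k))%N = #|G| by rewrite subnKC.
  have co_Gk : coprime #|G| k by rewrite coprime_sym.
  have co_k : coprime k (#|G| - k) by rewrite /coprime -gcdnDl cardG.
  have co_GGk : coprime #|G| (#|G| - k).
    by rewrite -[X in coprime X _]cardG /coprime gcdnC gcdnDr gcdnC.
  have cN := card_zsN_coprime co_Gk.
  have cN' := card_zsN_coprime co_GGk; rewrite bin_sub // in cN'.
  have cD : (#|G| * #|Dyck k (#|G| - k)|)%N = 'C(#|G|, k).
    by rewrite -(congr1 (binomial^~ k) cardG) -card_Dyck //; congr (_ * _)%N.
  have NN' : #|zsN G k| = #|zsN G (#|G| - k)|.
    by apply/eqP; rewrite -(eqn_pmul2l G_gt0) cN cN'.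
  have N'D : #|zsN G (#|G| - k)| = #|Dyck k (#|G| - k)|.
    by apply/eqP; rewrite -(eqn_pmul2l G_gt0) cN' cD.
  have bij (T U : finType) (A : {set T}) (B : {set U}) : #|A| = #|B| ->
      in_bijection (mem A) (mem B).
    move=> cAB; apply: (in_bijection_eq_size (enum_uniq A) (enum_uniq B)).
    - exact: mem_enum.
    - exact: mem_enum.
    - by rewrite -!cardE.
  split; [exact: bij | exact: bij | by apply: bij; rewrite NN' | split=> //].
    exact: natr_eq_div.
  by rewrite /Cat cardG.
- have G0 := card_zsM_coprime co_GH.
  have co_HG : coprime #|H| #|G| by rewrite coprime_sym.
  have H0 := card_zsM_coprime co_HG.
  rewrite addnC -[in RHS]bin_sub ?leq_addl // addnK in H0.
  have cD := card_Dyck G_gt0 co_GH.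
  have GH_gt0 : (0 < #|G| + #|H|)%N by rewrite addn_gt0 G_gt0.
  have MM' : #|` zsM G #|H| |%fset = #|` zsM H #|G| |%fset.
    by apply/eqP; rewrite -(eqn_pmul2l GH_gt0) G0 H0.
  have M'D : #|` zsM H #|G| |%fset = #|Dyck #|G| #|H| |.
    by apply/eqP; rewrite -(eqn_pmul2l GH_gt0) H0 cD.
  have Dyck_bij (K : finZmodType) l : #|` zsM K l |%fset = #|Dyck #|G| #|H| | ->
      in_bijection (mem (zsM K l)) (mem (Dyck #|G| #|H|)).
    move=> cKD; apply: (in_bijection_eq_size (fset_uniq _) (enum_uniq _)) => //.
    - exact: mem_enum.
    - by rewrite -cardE.
  split=> //.
  - exact: (in_bijection_eq_size (fset_uniq _) (fset_uniq _)).
  - exact: Dyck_bij.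
  - by apply: Dyck_bij; rewrite MM'.
  exact: natr_eq_div.
exact: card_zsM_isoCr.
Qed.
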